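(* Let $S$ be the multiset consisting of $2$ copies of each odd positive integer together with $2$ additional copies of each odd positive multiple of $11$, and let $T$ be the multiset consisting of $2$ copies of each even positive integer together with $2$ additional copies of each even positive multiple of $11$ (all copies distinct). Let $D_S(N)$ be the number of partitions of $N$ into distinct elements of $S$ having an odd number of parts, and $D_T(N)$ the number of partitions of $N$ into distinct elements of $T$. Then for every $N\ge 3$, $D_S(N)=2D_T(N-3)$.
   Context: A partition of $N$ into distinct elements of a multiset is a finite set of distinct elements of it (different copies of the same integer count as distinct elements) whose values sum to $N$. $D_T(0)=1$. *)

(* Defs.v *)
From mathcomp Require Import all_boot.
Set Implicit Arguments. Unset Strict Implicit. Unset Printing Implicit Defensive.

(* Multisets of positive integers, given by a multiplicity function.
   All multiplicities used here are at most 4, so the copies of a value v are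
   labelled (v, k) with k : 'I_4 and k < mult v. *)

Definition multS (v : nat) : nat :=
  if odd v then (if 11 %| v then 4 else 2) else 0.

Definition multT (v : nat) : nat :=
  if (0 < v) && ~~ odd v then (if 11 %| v then 4 else 2) else 0.

Definition is_copy (mult : nat -> nat) (N : nat) (x : 'I_N.+1 * 'I_4) : bool :=
  (0 < x.1) && (x.2 < mult x.1).

(* Number of partitions of N into distinct elements of the multiset (finite sets
   of distinct copies whose values sum to N) whose number of parts satisfies P.
   Every part of a partition of N is <= N, so copies with value <= N suffice. *)
Definition Dcount (mult : nat -> nat) (P : nat -> bool) (N : nat) : nat :=
  #|[set A : {set 'I_N.+1 * 'I_4} |
      [&& [forall x in A, is_copy mult x],
          (\sum_(x in A) (nat_of_ord x.1)) == N & P #|A| ] ]|.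

Definition D_S (N : nat) : nat := Dcount multS odd N.
Definition D_T (N : nat) : nat := Dcount multT (fun _ => true) N.

(* Main.v *)
(* Put P(s, r) = prod (1 + s r^(2i+1)) and T(r) = prod (1 + r^(2i+2)).  The
   claim amounts to
     (P(1,q) P(1,q^11))^2 - (P(-1,q) P(-1,q^11))^2
       = 4 q + 4 q^3 (T(q) T(q^11))^2,
   where the stray term 4 q is the reason for the bound 3 <= N.
   Multiplying by prod (1 - q^(2i)) (1 - q^(22i)), the Jacobi triple product
   turns the four terms into double theta series, and the identity becomes
     2 sum_(x+y odd) q^(x^2+11y^2) - sum_(a,b odd) q^((a^2+11b^2)/4)
       = 4 sum_(m,k) (-1)^(m+k) q^(((6m+1)^2+11(6k+1)^2)/12).
   All exponents are norms of elements (a + b sqrt(-11))/2; with u = (a+b)/2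
   the norm is u^2 - u b + 3 b^2, and the left side is twice the sum of
   (-1)^b q^norm over odd u.  Dividing by 1 + sqrt(-11) shows that the class
   u = 1 mod 6 is the right side's sum.  The class u = 5 equals it by negation,
   and the class u = 3 cancels: dividing by (1 - sqrt(-11))/2, conjugating and
   multiplying back reverses the sign (-1)^b.
   Power series are replaced by commutative rings in which q is nilpotent, so
   that all sums and products are finite. *)
Require Import Defs.
From mathcomp Require Import all_boot all_order all_algebra.
From mathcomp Require Import qpoly.
From mathcomp Require Import zify ring.
Set Implicit Arguments. Unset Strict Implicit. Unset Printing Implicit Defensive.
Import Order.TTheory GRing.Theory Num.Theory.
Local Open Scope ring_scope.

(** * The Jacobi triple product with a nilpotent base *)

(** The Gaussian binomial coefficient, given by a Pascal rule because quotients of [qpoch] need not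
    exist in [R]. *)
Fixpoint gbin (R : comNzRingType) (p : R) (m l : nat) : R :=
  match m, l with
  | _, 0 => 1
  | 0, _.+1 => 0
  | m'.+1, l'.+1 => gbin p m' l'.+1 + p ^+ (m' - l') * gbin p m' l'
  end.

Section JacobiTripleProduct.
Variables (R : comNzRingType) (p : R).

Lemma gbin0r m : gbin p m 0 = 1. Proof. by case: m. Qed.

Lemma gbinS m l :
  gbin p m.+1 l.+1 = gbin p m l.+1 + p ^+ (m - l) * gbin p m l.
Proof. by []. Qed.

Lemma gbin_small m l : (m < l)%N -> gbin p m l = 0.
Proof.
elim: m l => [|m IHm] [|l] //= lt_ml.
by rewrite !IHm ?mulr0 ?addr0 // ltnW.
Qed.

(** The mirror Pascal rule: [finite_jtp] uses it to add factors in [w], and [gbinS] to add factors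
    in [y]. *)
Lemma gbinSr m l : (l <= m)%N ->
  gbin p m.+1 l.+1 = gbin p m l + p ^+ l.+1 * gbin p m l.+1.
Proof.
elim: m l => [|m IHm] l; first by rewrite leqn0 => /eqP->; rewrite /= mulr0 addrC mulr1.
case: l => [|l] le_lm.
  rewrite [in LHS]gbinS [in LHS]IHm // [in RHS]gbinS !gbin0r !subn0 !exprS.
  by ring.
rewrite gbinS; case: (ltngtP l m) => [lt_lm|gt_lm|->]; last 2 first.
- by move: le_lm gt_lm; lia.
- by rewrite (gbin_small (ltnSn _)) mulr0 addr0 subnn mul1r add0r.
rewrite [in LHS](IHm l.+1 lt_lm) [in LHS](IHm l (ltnW lt_lm)) gbinS.
rewrite [gbin p m.+1 l.+2]gbinS.
have [d ->] : exists d, m = (l + d.+1)%N by exists (m - l.+1)%N; lia.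
have -> : ((l + d.+1).+1 - l.+1 = d.+1)%N by lia.
have -> : (l + d.+1 - l.+1 = d)%N by lia.
have -> : (l + d.+1 - l = d.+1)%N by lia.
rewrite !exprS; ring.
Qed.

Definition qpoch n : R := \prod_(i < n) (1 - p ^+ i.+1).

Lemma qpochS n : qpoch n.+1 = qpoch n * (1 - p ^+ n.+1).
Proof. by rewrite /qpoch big_ord_recr. Qed.

Lemma gbin_qpoch l k : gbin p (l + k) l * qpoch l * qpoch k = qpoch (l + k).
Proof.
have [m lem] := ubnP (l + k); elim: m l k lem => // m IHm l k lem.
case: l lem => [|l] lem; first by rewrite gbin0r add0n /qpoch big_ord0 !mul1r.
case: k lem => [|k] lem.
  rewrite addn0 {2}/qpoch big_ord0 mulr1.
  suff -> : gbin p l.+1 l.+1 = 1 by rewrite mul1r.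
  by elim: (l.+1) => // j IHj; rewrite gbinS gbin_small // subnn IHj mulr1 add0r.
rewrite addSn gbinS [in RHS]qpochS.
have := IHm l.+1 k ltac:(lia); have := IHm l k.+1 ltac:(lia).
rewrite !addnS !addSn => E1 E2.
(* The two Pascal terms recombine through [(1 - p^(k+1)) + p^(k+1) (1 - p^(l+1)) = 1 -
   p^(l+k+2)]. *)
transitivity (gbin p (l + k).+1 l.+1 * qpoch l.+1 * qpoch k * (1 - p ^+ k.+1) +
   p ^+ k.+1 * (gbin p (l + k).+1 l * qpoch l * qpoch k.+1) * (1 - p ^+ l.+1)).
  have -> : ((l + k).+1 - l = k.+1)%N by lia.
  by rewrite !qpochS; ring.
rewrite E1 E2.
have -> : (l + k).+2 = (k.+1 + l.+1)%N by lia.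
by rewrite [in RHS]exprD; ring.
Qed.

Variables (y w : R).

(* The term z^k p^(k^2/2) of the triple product for k = l - b, where
   y = z p^(1/2) and w = z^-1 p^(1/2). *)
Definition jtp_term b l : R :=
  if (b <= l)%N then y ^+ (l - b) * p ^+ 'C(l - b, 2)
  else w ^+ (b - l) * p ^+ 'C(b - l, 2).

Hypothesis ywp : y * w = p.

Lemma jtp_termSS b l : jtp_term b.+1 l.+1 = jtp_term b l.
Proof. by rewrite /jtp_term ltnS !subSS. Qed.

(** The power of [p] left over by the shift is the weight in [gbinS]; the one in [jtp_term_w] is the
    weight in [gbinSr]. *)
Lemma jtp_term_y a b l : (l <= a + b)%N ->
  jtp_term b l * (y * p ^+ a) = jtp_term b l.+1 * p ^+ (a + b - l).
Proof.
rewrite /jtp_term => le_l; case: (leqP b l) => [le_bl|lt_lb].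
  rewrite (leqW le_bl) subSn // binS bin1.
  have -> : (a = (l - b) + (a + b - l))%N by lia.
  have -> : (l - b + (a + b - l) + b - l = a + b - l)%N by lia.
  rewrite exprS !exprD; ring.
(* At [b = l + 1] the term passes from powers of [w] to powers of [y], and [y * w = p] supplies the
   extra power of [p]. *)
case: (leqP b l.+1) => [le_bl|lt_lb'].
  have -> : (b - l = 1)%N by lia.
  have -> : (l.+1 - b = 0)%N by lia.
  have -> : (a + b - l = a.+1)%N by lia.
  have -> : p ^+ a.+1 = y * w * p ^+ a by rewrite ywp exprS.
  by rewrite !bin_small //; ring.
have -> : (b - l = (b - l.+1).+1)%N by lia.
have -> : (a + b - l = a + (b - l.+1).+1)%N by lia.
have E : p ^+ (b - l.+1).+1 = y * w * p ^+ (b - l.+1) by rewrite ywp exprS.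
rewrite binS bin1 !exprD E exprS; ring.
Qed.

Lemma jtp_term_w b l : (l <= b)%N ->
  jtp_term b l * (w * p ^+ b) = jtp_term b.+1 l * p ^+ l.
Proof.
move=> le_lb; rewrite /jtp_term [(b < l)%N]ltnNge le_lb /= subSn // binS bin1 exprS.
case: (leqP b l) => [le_bl|lt_lb].
  have -> : l = b by lia.
  by rewrite subnn !bin_small //= expr0; ring.
rewrite !exprD.
have -> : p ^+ b = p ^+ (b - l) * p ^+ l by rewrite -exprD subnK.
ring.
Qed.

Arguments gbin : simpl never.

(** A two-sided q-binomial theorem. Induction on [b] with [a = 0], then on [a]: each new factor
    produces the two terms of a Pascal rule. *)
Lemma finite_jtp a b :
  \prod_(i < a) (1 + y * p ^+ i) * \prod_(i < b) (1 + w * p ^+ i) =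
  \sum_(l < (a + b).+1) gbin p (a + b) l * jtp_term b l.
Proof.
elim: a => [|a IHa].
  rewrite big_ord0 mul1r add0n; elim: b => [|b IHb].
    by rewrite big_ord0 big_ord_recl big_ord0 gbin0r /jtp_term /= !mulr1 addr0.
  rewrite big_ord_recr IHb /= mulrDr mulr1 mulr_suml.
  under eq_bigr => l _ do rewrite -jtp_termSS.
  under [X in _ + X]eq_bigr => l _.
    rewrite -mulrA jtp_term_w; last by rewrite -ltnS.
    over.
  rewrite [in RHS]big_ord_recl /= gbin0r mul1r [X in _ + X]big_ord_recl /= gbin0r.
  rewrite expr0 mulr1 mul1r addrCA; congr (_ + _).
  under [in RHS]eq_bigr => l _.
    rewrite /bump /= add1n gbinSr; last by rewrite -ltnS.
    rewrite mulrDl; over.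
  rewrite big_split /=; congr (_ + _); rewrite [in RHS]big_ord_recr /=.
  rewrite (gbin_small (ltnSn _)) mulr0 mul0r addr0.
  by apply: eq_bigr => i _; rewrite /bump /= add1n; ring.
rewrite big_ord_recr /= -mulrA [X in _ * X]mulrC mulrA IHa mulrDr mulr1.
rewrite mulr_suml addSn.
under [X in _ + X]eq_bigr => l _.
  rewrite -mulrA jtp_term_y; last by rewrite -ltnS.
  over.
rewrite [in RHS]big_ord_recl /= gbin0r mul1r big_ord_recl /= gbin0r mul1r.
rewrite -addrA; congr (_ + _).
under [in RHS]eq_bigr => l _ do rewrite /bump /= add1n gbinS mulrDl.
rewrite big_split /= [X in _ = X + _]big_ord_recr /=.
rewrite (gbin_small (ltnSn _)) mul0r addr0; congr (_ + _).
by apply: eq_bigr => i _; ring.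
Qed.

Variable K : nat.
Hypothesis pK : p ^+ K = 0.

Lemma nilp_expr m : (K <= m)%N -> p ^+ m = 0.
Proof. by move=> leKm; rewrite -(subnK leKm) exprD pK mulr0. Qed.

Lemma qpoch_stable m : (K <= m)%N -> qpoch m = qpoch K.
Proof.
elim: m => [|m IHm]; first by rewrite leqn0 => /eqP->.
rewrite leq_eqVlt => /orP[/eqP-> //|lt_Km].
by rewrite qpochS IHm // nilp_expr ?subr0 ?mulr1 // ltnW.
Qed.

(** Each factor [1 - p ^+ m.+1] is a unit: its inverse is a geometric sum, finite by nilpotency. *)
Lemma qpoch_lreg m : GRing.lreg (qpoch m).
Proof.
elim: m => [|m IHm]; first by rewrite /qpoch big_ord0; exact: lreg1.
rewrite qpochS; apply: lregM => // x x' eq_xx'.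
have inv1 : (\sum_(i < K) (p ^+ m.+1) ^+ i) * (1 - p ^+ m.+1) = 1.
  rewrite mulrC -opprB mulNr -subrX1 exprAC pK expr0n; case: K pK => [|k _].
    by rewrite expr0 => /eqP; rewrite oner_eq0.
  by rewrite /= sub0r opprK.
by rewrite -[x]mul1r -[x']mul1r -inv1 -!mulrA eq_xx'.
Qed.

(** In [finite_jtp], if [l] and [2n - l] are at least [K], all the [qpoch] involved agree and the
    binomial is the inverse of [qpoch n]. For the other [l], [n >= 2K] puts [l] more than [K] away
    from [n], and the term vanishes. *)
Lemma jacobi_triple_product n : (K.*2 <= n)%N ->
  \prod_(i < n) (1 + y * p ^+ i) * \prod_(i < n) (1 + w * p ^+ i) * qpoch n =
  \sum_(l < n.*2.+1) jtp_term n l.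
Proof.
move=> leKn; rewrite finite_jtp addnn mulr_suml; apply: eq_bigr => l _.
have qn m : (K <= m)%N -> qpoch m = qpoch n.
  by move=> leKm; rewrite !qpoch_stable //; lia.
have [/andP[leKl leKnl]|small] := boolP ((K <= l) && (K <= n.*2 - l))%N.
  rewrite mulrAC; suff -> : gbin p n.*2 l * qpoch n = 1 by rewrite mul1r.
  apply: (@qpoch_lreg n); rewrite mulr1.
  have := gbin_qpoch l (n.*2 - l); rewrite subnKC; last by rewrite -ltnS.
  rewrite (qn l) // (qn (n.*2 - l)%N) // (qn n.*2); last by lia.
  by rewrite mulrC.
suff -> : jtp_term n l = 0 by rewrite mulr0 mul0r.
have binK j : (K < j)%N -> p ^+ 'C(j, 2) = 0.
  case: j => // j ltKj; apply: nilp_expr; rewrite binS bin1; lia.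
by rewrite /jtp_term; case: leqP => cmp; rewrite binK ?mulr0 //; lia.
Qed.

End JacobiTripleProduct.

(** * Lattice sums *)

Definition zrange n : seq int := [seq l%:Z - n%:Z | l <- iota 0 n.*2.+1].

Lemma mem_zrange n x : (x \in zrange n) = (`|x| <= n)%N.
Proof.
apply/mapP/idP => [[l] | le_xn]; first by rewrite mem_iota; lia.
exists (absz (x + n%:Z)); last by lia.
by rewrite mem_iota; lia.
Qed.

Lemma zrange_uniq n : uniq (zrange n).
Proof. by rewrite map_inj_uniq ?iota_uniq // => x y; lia. Qed.

Lemma sum_zrange (R : nmodType) n (F : int -> R) :
  \sum_(l < n.*2.+1) F (l%:Z - n%:Z) = \sum_(x <- zrange n) F x.
Proof.
rewrite big_map -(big_mkord xpredT (fun l => F (l%:Z - n%:Z))).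
by rewrite /index_iota subn0.
Qed.

Definition zbox n := [seq (x, y) | x <- zrange n, y <- zrange n].

Lemma mem_zbox n x y : ((x, y) \in zbox n) = (`|x| <= n)%N && (`|y| <= n)%N.
Proof.
rewrite -!mem_zrange; apply/allpairsP/andP => [[[a b] [? ? [-> ->]]]|[]] //.
by exists (x, y).
Qed.

Lemma zbox_uniq n : uniq (zbox n).
Proof. by apply: allpairs_uniq; rewrite ?zrange_uniq // => -[? ?] [? ?]. Qed.

Lemma sum_zbox (R : pzRingType) n (F G : int -> R) :
  (\sum_(x <- zrange n) F x) * (\sum_(y <- zrange n) G y) =
  \sum_(z <- zbox n) F z.1 * G z.2.
Proof. by rewrite big_distrlr /= big_allpairs. Qed.

(** Only nonzero terms need to be matched: a change of lattice coordinates does not preserve the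
    box, but what leaves it contributes zero. *)
Lemma eq_big_partial_bij (R : nmodType) (S T : eqType) (s : seq S) (t : seq T)
    (h : S -> T) (h' : T -> S) (F : S -> R) (G : T -> R) :
  uniq s -> uniq t ->
  {in s, forall x, F x != 0 -> [/\ h x \in t, h' (h x) = x & G (h x) = F x]} ->
  {in t, forall y, G y != 0 -> [/\ h' y \in s, h (h' y) = y & F (h' y) = G y]} ->
  \sum_(x <- s) F x = \sum_(y <- t) G y.
Proof.
move=> us ut hP h'P.
have nz (U : eqType) (r : seq U) (H : U -> R) :
    \sum_(x <- r) H x = \sum_(x <- r | H x != 0) H x.
  by rewrite [RHS]big_rmcond // => x; rewrite negbK => /eqP.
rewrite nz [RHS]nz -big_filter -[RHS]big_filter.
have -> : \sum_(x <- [seq x <- s | F x != 0]) F x =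
    \sum_(y <- map h [seq x <- s | F x != 0]) G y.
  rewrite big_map; apply: eq_big_seq => x; rewrite mem_filter => /andP[Fx sx].
  by have [] := hP x sx Fx.
apply: perm_big; apply: uniq_perm; rewrite ?filter_uniq //.
  rewrite map_inj_in_uniq ?filter_uniq // => x y.
  rewrite !mem_filter => /andP[Fx sx] /andP[Fy sy] eq_h.
  have [_ Ex _] := hP x sx Fx; have [_ Ey _] := hP y sy Fy.
  by rewrite -Ex eq_h Ey.
move=> y; rewrite mem_filter; apply/mapP/andP => [[x] | [Gy ty]].
  by rewrite mem_filter => /andP[Fx sx] ->; have [? _ ->] := hP x sx Fx.
have [sy hy Fy] := h'P y ty Gy; exists (h' y); last by [].
by rewrite mem_filter Fy Gy.
Qed.

Section LatticeSums.
Variables (A : comNzRingType) (q : A) (K n : nat).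
Hypotheses (qK : q ^+ K = 0) (leKn : (4 * K <= n)%N).

(** A common shape for the double theta series: [C] selects lattice points, [c] is the parity of the
    sign, [e] the exponent. *)
Definition lsum (C c : int -> int -> bool) (e : int -> int -> int) : A :=
  \sum_(z <- zbox n)
    if C z.1 z.2 then (-1) ^+ (c z.1 z.2) * q ^+ `|e z.1 z.2| else 0.

Lemma lsum_reindex (h1 h2 g1 g2 : int -> int -> int) (C c C' c' : int -> int -> bool)
    (e e' : int -> int -> int) :
  (forall x y, C x y -> (`|e x y| < K)%N ->
     let u := h1 x y in let v := h2 x y in
     [/\ (`|u| <= n)%N && (`|v| <= n)%N, g1 u v = x /\ g2 u v = y,
         C' u v, c' u v = c x y & e' u v = e x y]) ->
  (forall u v, C' u v -> (`|e' u v| < K)%N ->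
     let x := g1 u v in let y := g2 u v in
     [/\ (`|x| <= n)%N && (`|y| <= n)%N, h1 x y = u /\ h2 x y = v,
         C x y, c x y = c' u v & e x y = e' u v]) ->
  lsum C c e = lsum C' c' e'.
Proof.
have vanish (b s : bool) m :
    (if b then (-1) ^+ s * q ^+ m else 0) != 0 -> b /\ (m < K)%N.
  case: b => [|/eqP//]; rewrite ltnNge => nz; split=> //.
  by apply: contraNN nz => leKm; rewrite (nilp_expr qK) ?mulr0.
move=> hP gP; rewrite /lsum.
apply: (eq_big_partial_bij (h := fun z => (h1 z.1 z.2, h2 z.1 z.2))
          (h' := fun z => (g1 z.1 z.2, g2 z.1 z.2))); try exact: zbox_uniq.
  move=> [x y] _ /vanish[/= Cxy ltK].
  have [inb [E1 E2] C'uv -> ->] := hP x y Cxy ltK.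
  by rewrite mem_zbox inb E1 E2 C'uv Cxy.
move=> [u v] _ /vanish[/= C'uv ltK].
have [inb [E1 E2] Cxy -> ->] := gP u v C'uv ltK.
by rewrite mem_zbox inb E1 E2 C'uv Cxy.
Qed.

(* The norm of (a + b sqrt(-11))/2 with a = 2 u - b. *)
Definition nform (u b : int) : int := u * u - u * b + 3 * b * b.

(** Completing the square in each variable: [E4] bounds [b] and [E12] bounds [u]. The coordinate
    changes below then stay within [4 * K]. *)
Lemma nform_bound u b : (`|nform u b| < K)%N -> (`|u| <= 2 * K)%N && (`|b| <= K)%N.
Proof.
rewrite /nform => ltK.
have E4 : (2 * u - b) ^+ 2 + 11 * b ^+ 2 = 4 * (u * u - u * b + 3 * b * b) by ring.
have E12 : 11 * u ^+ 2 + (u - 6 * b) ^+ 2 = 12 * (u * u - u * b + 3 * b * b) by ring.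
have := sqr_ge0 (2 * u - b); have := sqr_ge0 (u - 6 * b).
move=> p1 p2; apply/andP; split; nia.
Qed.

Notation oddz x := (odd (absz x)).

(** The element [x + y sqrt(-11)] has [a = 2x] and [b = 2y], hence [u = x + y]. *)
Lemma lsum_even :
  lsum (fun x y => oddz (x + y)) (fun _ _ => false) (fun x y => x * x + 11 * (y * y)) =
  lsum (fun u b => oddz u && ~~ oddz b) (fun _ _ => false) nform.
Proof.
apply: (lsum_reindex (h1 := fun x y => x + y) (h2 := fun _ y => 2 * y)
          (g1 := fun u b => u - (b %/ 2)%Z) (g2 := fun u b => (b %/ 2)%Z)).
  move=> x y Cxy ltK; have E : nform (x + y) (2 * y) = x * x + 11 * (y * y).
    by rewrite /nform; ring.
  have := @nform_bound (x + y) (2 * y); rewrite E => /(_ ltK) bnd.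
  by split=> //; lia.
move=> u b C ltK; have := nform_bound ltK => bnd.
have [y Eb] : exists y, b = 2 * y by exists (b %/ 2)%Z; lia.
have -> : (b %/ 2)%Z = y by lia.
by split; first [lia | by rewrite /nform Eb; ring].
Qed.

(** Here [a = 2x - 1] and [b = 2y - 1], hence [u = x + y - 1]. *)
Lemma lsum_odd :
  lsum (fun _ _ => true) (fun _ _ => false)
       (fun x y => 3 + (x * x - x) + 11 * (y * y - y)) =
  lsum (fun _ b => oddz b) (fun _ _ => false) nform.
Proof.
apply: (lsum_reindex (h1 := fun x y => x + y - 1) (h2 := fun _ y => 2 * y - 1)
          (g1 := fun u b => u - ((b - 1) %/ 2)%Z) (g2 := fun u b => ((b + 1) %/ 2)%Z)).
  move=> x y _ ltK.
  have E : nform (x + y - 1) (2 * y - 1) = 3 + (x * x - x) + 11 * (y * y - y).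
    by rewrite /nform; ring.
  have := @nform_bound (x + y - 1) (2 * y - 1); rewrite E => /(_ ltK) bnd.
  by split=> //; lia.
move=> u b C ltK; have := nform_bound ltK => bnd.
have [y Eb] : exists y, b = 2 * y - 1 by exists ((b + 1) %/ 2)%Z; lia.
have -> : ((b + 1) %/ 2)%Z = y by lia.
have -> : ((b - 1) %/ 2)%Z = y - 1 by lia.
by split; first [lia | by rewrite /nform Eb; ring].
Qed.

(** Complex conjugation fixes [a] and negates [b]; for odd [b] it flips the parity of [u]. *)
Lemma lsum_conj :
  lsum (fun u b => ~~ oddz u && oddz b) (fun _ _ => false) nform =
  lsum (fun u b => oddz u && oddz b) (fun _ _ => false) nform.
Proof.
apply: (lsum_reindex (h1 := fun u b => u - b) (h2 := fun _ b => - b)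
          (g1 := fun u b => u - b) (g2 := fun _ b => - b)) => u b C ltK;
  have := nform_bound ltK => bnd; split; first [lia | by rewrite /nform; ring].
Qed.

(** Dividing [(6m+1) + (6k+1) sqrt(-11)] by [1 + sqrt(-11)], of norm 12, gives [a = m + 11k + 2] and
    [b = k - m], hence [u = 6k + 1]. *)
Lemma lsum_pentagonal :
  lsum (fun _ _ => true) (fun m k => oddz (m + k))
       (fun m k => 1 + (3 * m * m + m) + 11 * (3 * k * k + k)) =
  lsum (fun u _ => (u %% 6)%Z == 1) (fun _ b => oddz b) nform.
Proof.
apply: (lsum_reindex (h1 := fun m k => 6 * k + 1) (h2 := fun m k => k - m)
          (g1 := fun u b => (u %/ 6)%Z - b) (g2 := fun u b => (u %/ 6)%Z)).
  move=> m k _ ltK.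
  have E : nform (6 * k + 1) (k - m) = 1 + (3 * m * m + m) + 11 * (3 * k * k + k).
    by rewrite /nform; ring.
  have := @nform_bound (6 * k + 1) (k - m); rewrite E => /(_ ltK) bnd.
  by split=> //; lia.
move=> u b C ltK; have := nform_bound ltK => bnd.
have [k Eu] : exists k, u = 6 * k + 1 by exists (u %/ 6)%Z; lia.
have -> : (u %/ 6)%Z = k by lia.
by split; first [lia | by rewrite /nform Eu; ring].
Qed.

Lemma lsum_opp :
  lsum (fun u _ => (u %% 6)%Z == 5) (fun _ b => oddz b) nform =
  lsum (fun u _ => (u %% 6)%Z == 1) (fun _ b => oddz b) nform.
Proof.
apply: (lsum_reindex (h1 := fun u b => - u) (h2 := fun _ b => - b)
          (g1 := fun u b => - u) (g2 := fun _ b => - b)) => u b C ltK;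
  have := nform_bound ltK => bnd; split; first [lia | by rewrite /nform; ring].
Qed.

(* For u = 3 d with d odd, the map fixes the norm and shifts b by d. *)
Lemma lsum_reflect :
  lsum (fun u _ => (u %% 6)%Z == 3) (fun _ b => oddz b) nform =
  lsum (fun u _ => (u %% 6)%Z == 3) (fun _ b => ~~ oddz b) nform.
Proof.
by apply: (lsum_reindex (h1 := fun u b => - u) (h2 := fun u b => b - (u %/ 3)%Z)
          (g1 := fun u b => - u) (g2 := fun u b => b - (u %/ 3)%Z)) => u b C ltK;
  have := nform_bound ltK => bnd;
  have [d Eu] : (exists d, u = 3 * d) by [exists (u %/ 3)%Z; lia];
  have -> : (u %/ 3)%Z = d by [lia];
  split; first [lia | by rewrite /nform Eu; ring].
Qed.

Lemma lattice_identity :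
  \sum_(z <- zbox n) (1 - (-1) ^+ `|z.1 + z.2|) * q ^+ `|z.1 * z.1 + 11 * (z.2 * z.2)|
  - \sum_(z <- zbox n) q ^+ `|3 + (z.1 * z.1 - z.1) + 11 * (z.2 * z.2 - z.2)|
  = 4 * \sum_(z <- zbox n) (-1) ^+ `|z.1 + z.2|
       * q ^+ `|1 + (3 * z.1 * z.1 + z.1) + 11 * (3 * z.2 * z.2 + z.2)|.
Proof.
transitivity (2 * lsum (fun x y => oddz (x + y)) (fun _ _ => false)
                       (fun x y => x * x + 11 * (y * y))
   - lsum (fun _ _ => true) (fun _ _ => false)
       (fun x y => 3 + (x * x - x) + 11 * (y * y - y))).
  congr (_ - _); last by apply: eq_bigr => z _; rewrite mul1r.
  rewrite /lsum mulr_sumr; apply: eq_bigr => z _.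
  rewrite -signr_odd; case: odd; rewrite /= ?expr1 ?expr0.
    by ring.
  by rewrite subrr mul0r mulr0.
have -> : \sum_(z <- zbox n) (-1) ^+ `|z.1 + z.2|
       * q ^+ `|1 + (3 * z.1 * z.1 + z.1) + 11 * (3 * z.2 * z.2 + z.2)| =
   lsum (fun _ _ => true) (fun m k => oddz (m + k))
       (fun m k => 1 + (3 * m * m + m) + 11 * (3 * k * k + k)).
  by apply: eq_bigr => z _; rewrite signr_odd.
rewrite lsum_even lsum_odd lsum_pentagonal.
have -> : lsum (fun _ b => oddz b) (fun _ _ => false) nform =
    2 * lsum (fun u b => oddz u && oddz b) (fun _ _ => false) nform.
  rewrite mulr_natl mulr2n -[X in X + _]lsum_conj /lsum -big_split.
  by apply: eq_bigr => z _; do 2!case: odd; rewrite /= ?addr0 ?add0r.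
(* The left side is now twice a signed sum over odd [u], split by the classes 1, 5, 3 modulo 6. *)
transitivity (2 * (lsum (fun u _ => (u %% 6)%Z == 1) (fun _ b => oddz b) nform
  + lsum (fun u _ => (u %% 6)%Z == 5) (fun _ b => oddz b) nform)
  + 2 * lsum (fun u _ => (u %% 6)%Z == 3) (fun _ b => oddz b) nform).
  rewrite -mulrBr -mulrDr; congr (2 * _); rewrite /lsum -sumrB -!big_split.
  apply: eq_bigr => z _ /=; set X := q ^+ _.
  have [o1|o1] := boolP (oddz z.1).
    have : [|| (z.1 %% 6)%Z == 1, (z.1 %% 6)%Z == 5 | (z.1 %% 6)%Z == 3] by lia.
    by case/or3P => /eqP ->; case: odd; rewrite /= ?expr1 ?expr0; ring.
  have [-> [-> ->]] : ((z.1 %% 6)%Z == 1) = false /\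
     ((z.1 %% 6)%Z == 5) = false /\ ((z.1 %% 6)%Z == 3) = false by lia.
  by rewrite /= subrr !addr0.
(* By [lsum_reflect] this sum is its own negative. The factor 2 is kept because 2 may be a zero
   divisor in [A]. *)
have -> : 2 * lsum (fun u _ => (u %% 6)%Z == 3) (fun _ b => oddz b) nform = 0.
  rewrite mulr_natl mulr2n [X in X + _]lsum_reflect /lsum -big_split big1 // => z _.
  case: eqP => _; last by rewrite /= addr0.
  by case: odd; rewrite /= ?expr1 ?expr0; ring.
by rewrite lsum_opp; ring.
Qed.

End LatticeSums.

(** * Theta products *)

Lemma sqrn_bin2 j : (j * j = 2 * 'C(j, 2) + j)%N.
Proof. by elim: j => // j IHj; rewrite binS bin1; lia. Qed.

Lemma prod_stable (A : comNzRingType) (r s : A) K c m m' :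
  r ^+ K = 0 -> (K <= m)%N -> (m <= m')%N ->
  \prod_(i < m') (1 + s * r ^+ (2 * i + c)) = \prod_(i < m) (1 + s * r ^+ (2 * i + c)).
Proof.
move=> rK leKm; elim: m' => [|m' IHm']; first by rewrite leqn0 => /eqP->.
rewrite leq_eqVlt => /orP[/eqP-> //|]; rewrite ltnS => le_mm'.
by rewrite big_ord_recr /= (IHm' le_mm') (nilp_expr rK) ?mulr0 ?addr0 ?mulr1 //; lia.
Qed.

Section ThetaProducts.
Variables (A : comNzRingType) (K n : nat).
Hypothesis (leKn : (K.*2 <= n)%N).

(** The triple product at [y = s r^a], [w = s r^b], [p = r^(a+b)], where [s * s = 1] ensures
    [y * w = p]. The two conditions on [e] match the two branches of [jtp_term]. *)
Lemma theta_jtp (r s : A) (a b : nat) (e : int -> int) :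
  r ^+ K = 0 -> s * s = 1 -> (0 < a + b)%N ->
  (forall j : nat, e j = ((a + b) * 'C(j, 2) + a * j)%N) ->
  (forall j : nat, e (- j%:Z) = ((a + b) * 'C(j, 2) + b * j)%N) ->
  \prod_(i < n) (1 + s * r ^+ a * (r ^+ (a + b)) ^+ i) *
  \prod_(i < n) (1 + s * r ^+ b * (r ^+ (a + b)) ^+ i) * qpoch (r ^+ (a + b)) n
  = \sum_(x <- zrange n) s ^+ `|x| * r ^+ `|e x|.
Proof.
move=> rK ss ab_gt0 e_nat e_opp.
rewrite (@jacobi_triple_product _ (r ^+ (a + b)) _ _ _ K) //; first last.
- by rewrite -exprM (nilp_expr rK) // leq_pmull.
- by rewrite mulrACA ss mul1r -exprD.
rewrite -sum_zrange; apply: eq_bigr => l _; rewrite /jtp_term.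
rewrite !exprMn -!exprM -!mulrA -!exprD.
case: leqP => cmp.
  have -> : l%:Z - n%:Z = (l - n)%N by lia.
  by rewrite e_nat; congr (_ * _ ^+ _); rewrite absz_nat addnC.
have -> : l%:Z - n%:Z = - (n - l)%N%:Z by lia.
by rewrite e_opp abszN; congr (_ * _ ^+ _); rewrite absz_nat addnC.
Qed.

Lemma phi_jtp (r s : A) : r ^+ K = 0 -> s * s = 1 ->
  (\prod_(i < n) (1 + s * r ^+ (2 * i + 1))) ^+ 2 * qpoch (r ^+ 2) n =
  \sum_(x <- zrange n) s ^+ `|x| * r ^+ `|x * x|.
Proof.
move=> rK ss; rewrite -(@theta_jtp r s 1 1 (fun x => x * x)) //.
- rewrite -expr2; congr (_ ^+ 2 * _); apply: eq_bigr => i _.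
  by rewrite -mulrA -exprM -exprD addnC.
- by move=> j; have := sqrn_bin2 j; lia.
- by move=> j; have := sqrn_bin2 j; lia.
Qed.

(** With [a = 0] the first factor is [1 + r^0 = 2]. The remaining [n - 1] factors agree with the
    other product, whose last factor is 1 by nilpotency. *)
Lemma psi_jtp (r : A) : r ^+ K = 0 ->
  2 * (\prod_(i < n) (1 + r ^+ (2 * i + 2))) ^+ 2 * qpoch (r ^+ 2) n =
  \sum_(x <- zrange n) r ^+ `|(x * x - x)%R|.
Proof.
move=> rK; case: (posnP n) => [n0|n_gt0].
  have K0 : K = 0%N by lia.
  by move: rK; rewrite K0 expr0 => /eqP; rewrite oner_eq0.
transitivity (\sum_(x <- zrange n) 1 ^+ `|x| * r ^+ `|(x * x - x)%R|); last first.
  by apply: eq_bigr => x _; rewrite expr1n mul1r.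
rewrite -(@theta_jtp r 1 0 2 (fun x => x * x - x)) ?mulr1 //; first last.
- by move=> j; have := sqrn_bin2 j; lia.
- by move=> j; have := sqrn_bin2 j; lia.
congr (_ * _); rewrite expr2 mulrA; congr (_ * _); last first.
  by apply: eq_bigr => i _; rewrite mul1r -exprM -exprD addnC.
case: n leKn n_gt0 => // m leKm _.
rewrite [in RHS]big_ord_recl /= !expr0 !mul1r; congr (2 * _).
rewrite big_ord_recr /= (nilp_expr rK) ?addr0 ?mulr1; last by lia.
by apply: eq_bigr => i _; rewrite mul1r -exprM; congr (_ + _ ^+ _); rewrite /bump; lia.
Qed.

(** Euler's pentagonal number theorem in [r^2]: the exponents [6i+2], [6i+4], [6i+6] run through all
    even numbers. This gives [3n] factors, of which those past the first [n] are 1. *)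
Lemma pentagonal_jtp (r : A) : r ^+ K = 0 ->
  qpoch (r ^+ 2) n = \sum_(x <- zrange n) (-1) ^+ `|x| * r ^+ `|3 * x * x + x|.
Proof.
move=> rK; rewrite -(@theta_jtp r (-1) 4 2 (fun x => 3 * x * x + x)) //; first last.
- by move=> j; have := sqrn_bin2 j; lia.
- by move=> j; have := sqrn_bin2 j; lia.
- by rewrite mulrNN mulr1.
have qpE m : qpoch (r ^+ 2) m = \prod_(i < m) (1 + -1 * r ^+ (2 * i + 2)).
  by apply: eq_bigr => i _; rewrite mulN1r -exprM; congr (_ - _ ^+ _); lia.
rewrite qpE -(@prod_stable _ r (-1) K 2 n (n * 3)) //; [|lia..].
elim: (n) => [|m IHm]; first by rewrite /qpoch !big_ord0 !mulr1.
have -> : (m.+1 * 3 = (m * 3).+3)%N by lia.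
rewrite !big_ord_recr /= IHm qpochS.
have -> : r ^+ (2 * (m * 3) + 2) = r ^+ 2 * r ^+ (4 + 2) ^+ m.
  by rewrite -exprM -exprD; congr (_ ^+ _); lia.
have -> : r ^+ (2 * (m * 3).+1 + 2) = r ^+ 4 * r ^+ (4 + 2) ^+ m.
  by rewrite -exprM -exprD; congr (_ ^+ _); lia.
have -> : r ^+ (2 * (m * 3).+2 + 2) = r ^+ (4 + 2) ^+ m.+1.
  by rewrite -exprM; congr (_ ^+ _); lia.
by ring.
Qed.

End ThetaProducts.

Lemma signr_abszD (A : pzRingType) (x y : int) :
  (-1) ^+ (`|x| + `|y|) = (-1) ^+ `|x + y| :> A.
Proof. by rewrite -[LHS]signr_odd -[RHS]signr_odd; congr (_ ^+ _); lia. Qed.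

Lemma product_identity (A : comNzRingType) (q : A) (K n : nat) :
  q ^+ K = 0 -> (4 * K <= n)%N ->
  let P s r := \prod_(i < n) (1 + s * r ^+ (2 * i + 1)) in
  let T r := \prod_(i < n) (1 + r ^+ (2 * i + 2)) in
  (P 1 q * P 1 (q ^+ 11)) ^+ 2 - (P (-1) q * P (-1) (q ^+ 11)) ^+ 2 =
  4 * q + 4 * q ^+ 3 * (T q * T (q ^+ 11)) ^+ 2.
Proof.
move=> qK leKn P T; set t := q ^+ 11.
have tK : t ^+ K = 0 by rewrite -exprM (nilp_expr qK) // leq_pmull.
have leK2n : (K.*2 <= n)%N by lia.
have lreg (r : A) : r ^+ K = 0 -> GRing.lreg (qpoch (r ^+ 2) n).
  by move=> rK; apply: (@qpoch_lreg _ _ K); rewrite exprAC rK expr0n.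
(* Both [qpoch] factors are regular, so the identity may be checked after multiplying by them. *)
apply: (lregM (lreg q qK) (lreg t tK)).
set F := qpoch (q ^+ 2) n; set G := qpoch (t ^+ 2) n.
have phi (s : A) : s * s = 1 -> F * G * (P s q * P s t) ^+ 2 =
    \sum_(z <- zbox n) s ^+ (`|z.1| + `|z.2|) * q ^+ `|z.1 * z.1 + 11 * (z.2 * z.2)|.
  move=> ss; transitivity (P s q ^+ 2 * F * (P s t ^+ 2 * G)); first by ring.
  rewrite (phi_jtp leK2n qK ss) (phi_jtp leK2n tK ss) sum_zbox.
  apply: eq_bigr => -[x y] _ /=; rewrite mulrACA -exprD -exprM -exprD.
  by congr (_ * _ ^+ _); have := sqr_ge0 x; have := sqr_ge0 y; lia.
(* The 4 is spent on the factor 2 in each [psi_jtp], and [q ^+ 3] completes the exponent to a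
   norm. *)
have psi : F * G * (4 * q ^+ 3 * (T q * T t) ^+ 2) = \sum_(z <- zbox n)
    q ^+ `|3 + (z.1 * z.1 - z.1) + 11 * (z.2 * z.2 - z.2)|.
  transitivity (q ^+ 3 * (2 * T q ^+ 2 * F * (2 * T t ^+ 2 * G))); first by ring.
  rewrite (psi_jtp leK2n qK) (psi_jtp leK2n tK) sum_zbox mulr_sumr.
  apply: eq_bigr => -[x y] _ /=; rewrite -exprM -!exprD.
  by congr (_ ^+ _); have : 0 <= x * x - x /\ 0 <= y * y - y by [split; nia]; lia.
have pent : F * G * (4 * q) = 4 * \sum_(z <- zbox n) (-1) ^+ `|z.1 + z.2|
    * q ^+ `|1 + (3 * z.1 * z.1 + z.1) + 11 * (3 * z.2 * z.2 + z.2)|.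
  transitivity (4 * (q * (F * G))); first by ring.
  rewrite /F /G (pentagonal_jtp leK2n qK) (pentagonal_jtp leK2n tK) sum_zbox.
  congr (4 * _); rewrite mulr_sumr.
  apply: eq_bigr => -[x y] _ /=; rewrite mulrACA -exprD -exprM -exprD mulrCA -exprS.
  rewrite signr_abszD; congr (_ * _ ^+ _).
  by have : 0 <= 3 * x * x + x /\ 0 <= 3 * y * y + y by [split; nia]; lia.
rewrite mulrBr mulrDr phi ?mulr1 // phi ?mulrNN ?mulr1 // psi pent.
rewrite -(lattice_identity qK leKn) subrK -sumrB.
apply: eq_bigr => z _; by rewrite expr1n -mulrBl signr_abszD.
Qed.

(** * Generating functions of distinct partitions *)

Section GeneratingFunction.
Variable mult : nat -> nat.
Hypotheses (mult_le4 : forall v, (mult v <= 4)%N) (mult0 : mult 0 = 0%N).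

Definition gf (s : int) m : {poly int} := \prod_(v < m) (1 + s *: 'X^v) ^+ mult v.

(** Each power is spread over all four labels, a label that is no copy giving the factor 1;
    expanding the product then chooses a subset. *)
Lemma gf_subsets s N :
  gf s N.+1 = \sum_(J : {set 'I_N.+1 * 'I_4} | [forall x in J, is_copy mult x])
                s ^+ #|J| *: 'X^(\sum_(x in J) x.1).
Proof.
transitivity (\prod_(x : 'I_N.+1 * 'I_4)
   ((if is_copy mult x then s *: 'X^(x.1) else 0) + 1 : {poly int})).
  rewrite -(pair_bigA _ (fun v k : 'I__ =>
     (if is_copy mult (v, k) then s *: 'X^v else 0) + 1 : {poly int})) /=.
  apply: eq_bigr => v _; rewrite /is_copy /=.
  rewrite !big_ord_recr big_ord0 /= mul1r.
  case: (posnP v) => [->|_]; first by rewrite mult0 expr0 !add0r !mulr1.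
  move: (mult_le4 v); case: (mult v) => [|[|[|[|[|//]]]]] _ /=; ring.
rewrite bigA_distr [RHS]big_mkcond; apply: eq_big => // J _.
case: ifPn => [/forall_inP copyJ | /forall_inPn[x Jx /negPf notcopy]]; last first.
  by rewrite (bigD1 x) //= Jx notcopy mul0r.
rewrite -big_mkcond /=.
rewrite (eq_bigr _ (fun x Jx => congr1 (fun b => if b then _ else _) (copyJ x Jx))).
by rewrite scaler_prod prodr_const prodrXr.
Qed.

(** Factors with [v > N] do not affect the coefficient of [X^N], so [m] can be cut down to
    [N + 1]. *)
Lemma coef_gf s N m : (N < m)%N -> (gf s m)`_N =
  \sum_(J : {set 'I_N.+1 * 'I_4} | [forall x in J, is_copy mult x]
          && ((\sum_(x in J) nat_of_ord x.1)%N == N)) s ^+ #|J|.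
Proof.
move=> lt_Nm; have -> : (gf s m)`_N = (gf s N.+1)`_N.
  elim: m lt_Nm => // m IHm; rewrite ltnS leq_eqVlt => /orP[/eqP-> //|lt_Nm].
  rewrite -IHm // /gf big_ord_recr /=; elim: (mult m) => [|k IHk].
    by rewrite expr0 mulr1.
  rewrite exprSr mulrA mulrDr mulr1 -scalerAr coefD coefZ coefMXn lt_Nm.
  by rewrite mulr0 addr0.
rewrite gf_subsets coef_sum big_mkcondr; apply: eq_bigr => J _.
by rewrite coefZ coefXn eq_sym; case: eqP => _; rewrite ?mulr1 ?mulr0.
Qed.

Lemma Dcount_gf N m : (N < m)%N -> (Dcount mult (fun=> true) N)%:R = (gf 1 m)`_N.
Proof.
move=> lt_Nm; rewrite coef_gf // /Dcount -sum1_card natr_sum.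
apply: eq_big => [J|J _]; last by rewrite expr1n.
by rewrite inE andbT.
Qed.

(** The weight [1 - (-1)^#|J|] is 2 for an odd number of parts and 0 otherwise. *)
Lemma Dcount_odd_gf N m : (N < m)%N ->
  2 * (Dcount mult odd N)%:R = (gf 1 m - gf (-1) m)`_N.
Proof.
move=> lt_Nm; rewrite coefB !coef_gf // -sumrB /Dcount -sum1_card natr_sum mulr_sumr.
rewrite [LHS]big_mkcond [RHS]big_mkcond; apply: eq_bigr => J _.
rewrite inE andbA; case: ([forall x in J, is_copy mult x] && _) => //=.
by rewrite expr1n -signr_odd; case: odd; rewrite /= ?expr1 ?expr0; ring.
Qed.

End GeneratingFunction.

(** * Products over parts, split by parity and divisibility by 11 *)

Section PartProducts.
Variable R : comNzRingType.
Implicit Type F : nat -> R.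

Lemma prod_odd F h :
  \prod_(v < (2 * h).+1) (if odd v then F v else 1) = \prod_(i < h) F (2 * i + 1)%N.
Proof.
elim: h => [|h IHh]; first by rewrite big_ord_recr !big_ord0 /= mulr1.
have -> : (2 * h.+1 = (2 * h).+2)%N by lia.
rewrite !(big_ord_recr _.+1) /= IHh oddM /= mulr1 [RHS]big_ord_recr /=.
by congr (_ * F _); lia.
Qed.

Lemma prod_even F h :
  \prod_(v < (2 * h).+1) (if (0 < v)%N && ~~ odd v then F v else 1) =
  \prod_(i < h) F (2 * i + 2)%N.
Proof.
elim: h => [|h IHh]; first by rewrite big_ord_recr !big_ord0 /= mulr1.
have -> : (2 * h.+1 = (2 * h).+2)%N by lia.
rewrite !(big_ord_recr _.+1) /= IHh oddM /= mulr1 [RHS]big_ord_recr /=.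
by congr (_ * F _); lia.
Qed.

Lemma prod_dvdn F d h : (0 < d)%N ->
  \prod_(v < (d * h).+1) (if (d %| v)%N then F v else 1) = \prod_(i < h.+1) F (d * i)%N.
Proof.
move=> d_gt0; elim: h => [|h IHh].
  by rewrite muln0 !big_ord_recr !big_ord0 /= dvdn0 muln0.
rewrite [RHS]big_ord_recr /= -IHh.
have step j : (j < d)%N -> \prod_(v < (d * h + j).+1) (if (d %| v)%N then F v else 1) =
    \prod_(v < (d * h).+1) (if (d %| v)%N then F v else 1).
  elim: j => [|j IHj] lt_jd; first by rewrite addn0.
  rewrite addnS big_ord_recr /= (IHj (ltnW lt_jd)) -addnS dvdn_addr ?dvdn_mulr //.
  by rewrite gtnNdvd // mulr1.
rewrite -(step d.-1) ?ltn_predL // mulnS addnC -(prednK d_gt0) addnS big_ord_recr /=.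
by rewrite -addnS prednK // dvdn_addl ?dvdn_mulr // dvdnn addnC -mulnS.
Qed.

(** The multiplicity is twice the sum of the indicators of odd numbers and of odd multiples of 11.
    The bound [22 * n] ends both progressions evenly. *)
Lemma prod_multS F n :
  \prod_(v < (22 * n).+1) F v ^+ multS v =
  (\prod_(i < 11 * n) F (2 * i + 1)%N * \prod_(i < n) F (11 * (2 * i + 1))%N) ^+ 2.
Proof.
pose Fo v := if odd v then F v else 1.
transitivity ((\prod_(v < (2 * (11 * n)).+1) Fo v *
    \prod_(v < (11 * (2 * n)).+1) if (11 %| v)%N then Fo v else 1) ^+ 2).
  rewrite !mulnA -big_split -prodrXl; apply: eq_bigr => v _ /=.
  by rewrite /multS /Fo; case: odd; case: ifP => _; rewrite ?expr0; ring.
rewrite prod_odd prod_dvdn // -(prod_odd (fun i => F (11 * i)%N)).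
by congr ((_ * _) ^+ 2); apply: eq_bigr => i _; rewrite /Fo oddM.
Qed.

Lemma prod_multT F n :
  \prod_(v < (22 * n).+1) F v ^+ multT v =
  (\prod_(i < 11 * n) F (2 * i + 2)%N * \prod_(i < n) F (11 * (2 * i + 2))%N) ^+ 2.
Proof.
pose Fe v := if (0 < v)%N && ~~ odd v then F v else 1.
transitivity ((\prod_(v < (2 * (11 * n)).+1) Fe v *
    \prod_(v < (11 * (2 * n)).+1) if (11 %| v)%N then Fe v else 1) ^+ 2).
  rewrite !mulnA -big_split -prodrXl; apply: eq_bigr => v _ /=.
  by rewrite /multT /Fe; case: (_ && _); case: ifP => _; rewrite ?expr0; ring.
rewrite prod_even prod_dvdn // -(prod_even (fun i => F (11 * i)%N)).
by congr ((_ * _) ^+ 2); apply: eq_bigr => i _; rewrite /Fe oddM muln_gt0.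
Qed.

End PartProducts.

(** * Passage to truncated polynomials and conclusion *)

Lemma coef_in_qpolyXn (R : comNzRingType) K (p : {poly R}) i : (i < K)%N ->
  (in_qpoly 'X^K p : {poly R})`_i = p`_i.
Proof.
case: K => // K lt_iK; rewrite /= mk_monic_Xn /=.
rewrite [in RHS](Pdiv.RingMonic.rdivp_eq (monicXn _ K.+1) p) coefD coefMXn lt_iK.
by rewrite add0r.
Qed.

(** Modulo [X^(N+1)] the class of [X] is nilpotent, so [product_identity] applies, while the
    coefficient of [X^N] is still visible. *)
Lemma gf_multS_multT N n : (4 * N.+1 <= n)%N ->
  let m := (22 * n).+1 in
  (gf multS 1 m - gf multS (-1) m)`_N = (4 * 'X + 4 * 'X^3 * gf multT 1 m)`_N.
Proof.
move=> leKn m; set K := N.+1; pose h : {poly int} := 'X^K.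
suff eq_h : in_qpoly h (gf multS 1 m - gf multS (-1) m) =
    in_qpoly h (4 * 'X + 4 * 'X^3 * gf multT 1 m).
  rewrite -[LHS](coef_in_qpolyXn _ (ltnSn N)) -[RHS](coef_in_qpolyXn _ (ltnSn N)).
  by rewrite -/h eq_h.
pose q := in_qpoly h 'X.
have qK : q ^+ K = 0.
  rewrite /q -rmorphXn /=; apply/val_inj; rewrite /= mk_monic_Xn /=.
  by rewrite Pdiv.RingMonic.rmodpp ?monicXn.
have phi_gf mult s : in_qpoly h (gf mult s m) =
    \prod_(v < m) (1 + in_qpoly h s%:P * q ^+ v) ^+ mult v.
  rewrite /gf rmorph_prod; apply: eq_bigr => v _.
  by rewrite rmorphXn rmorphD rmorph1 -mul_polyC rmorphM rmorphXn.
have leK : (K <= n)%N by lia.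
have le_n : (n <= 11 * n)%N by rewrite leq_pmull.
have phiS s : in_qpoly h (gf multS s m) =
    (\prod_(i < n) (1 + in_qpoly h s%:P * q ^+ (2 * i + 1)) *
     \prod_(i < n) (1 + in_qpoly h s%:P * (q ^+ 11) ^+ (2 * i + 1))) ^+ 2.
  rewrite phi_gf (prod_multS (fun v => 1 + in_qpoly h s%:P * q ^+ v)).
  (* Parts up to [22 * n] give [11 * n] odd values; nilpotency trims them to the [n] factors of
     [product_identity]. *)
  rewrite (prod_stable _ _ qK leK le_n).
  by congr ((_ * _) ^+ 2); apply: eq_bigr => i _; rewrite -exprM.
have phiT : in_qpoly h (gf multT 1 m) =
    (\prod_(i < n) (1 + q ^+ (2 * i + 2)) *
     \prod_(i < n) (1 + (q ^+ 11) ^+ (2 * i + 2))) ^+ 2.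
  rewrite phi_gf (prod_multT (fun v => 1 + in_qpoly h 1%:P * q ^+ v)).
  rewrite (prod_stable _ _ qK leK le_n).
  congr ((_ * _) ^+ 2); apply: eq_bigr => i _; rewrite -?exprM rmorph1 mul1r //.
have phiX e : in_qpoly h ('X^e) = q ^+ e by rewrite rmorphXn.
have phi4 : in_qpoly h 4 = 4 by rewrite rmorph_nat.
have -> : in_qpoly h (4 * 'X + 4 * 'X^3 * gf multT 1 m) =
    4 * q + 4 * q ^+ 3 * in_qpoly h (gf multT 1 m).
  by rewrite in_qpolyD in_qpolyM [in_qpoly h (4 * 'X^3 * _)]in_qpolyM
    [in_qpoly h (4 * 'X^3)]in_qpolyM phiX phi4.
rewrite rmorphB /= !phiS phiT.
rewrite polyCN !rmorphN !rmorph1.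
exact: product_identity qK leKn.
Qed.

Local Close Scope ring_scope.

Theorem theorem3p13 (N : nat) : 3 <= N -> D_S N = 2 * D_T (N - 3).
Proof.
(* Both sides are doubled because [Dcount_odd_gf] computes [2 * D_S N]. *)
move=> le3N; apply/eqP; rewrite -(eqn_pmul2l (isT : 0 < 2)%N) mulnA.
rewrite -(eqr_nat int) !natrM; apply/eqP.
have bnd : (N < (22 * (4 * N.+1)).+1)%N by lia.
have bndT : (N - 3 < (22 * (4 * N.+1)).+1)%N by lia.
have multS_le4 v : (multS v <= 4)%N by rewrite /multS; do 2?case: ifP.
have multT_le4 v : (multT v <= 4)%N by rewrite /multT; do 2?case: ifP.
rewrite /D_S /D_T (Dcount_odd_gf multS_le4 _ bnd) // (Dcount_gf multT_le4 _ bndT) //.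
rewrite gf_multS_multT //; set G := gf multT 1 _.
have -> : (4 * 'X + 4 * 'X^3 * G = 4%:P * ('X + 'X^3 * G))%R.
  by rewrite -[(4%:P)%R]/(polyC 4%:R) polyC_natr mulrDr mulrA.
(* The stray ['X] only reaches index 1, excluded by [3 <= N]; the factor ['X^3] shifts the index to
   [N - 3]. *)
rewrite coefCM coefD coefX coefXnM gtn_eqF; last by lia.
by rewrite ltnNge le3N add0r -natrM.
Qed.
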